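(* Let $A,B,C,D$ be integers with $A^2+B^2=C^2+D^2$. Then there exist integers $r,s,u,v$ such that, up to signs and order within each of the two pairs, $(A,B)$ equals $(ru-sv,\;rv+su)$ and $(C,D)$ equals $(ru+sv,\;su-rv)$. That is, one has the equalities of multisets $$\{|A|,|B|\}=\{|ru-sv|,\,|rv+su|\}\quad\text{and}\quad \{|C|,|D|\}=\{|ru+sv|,\,|su-rv|\}.$$
   Context: The four-parameter (Brahmagupta--Fibonacci) parametrization assigns to integers $r,s,u,v$ the numbers $ru-sv$, $rv+su$, $ru+sv$, $su-rv$, which satisfy $(ru-sv)^2+(rv+su)^2=(ru+sv)^2+(su-rv)^2$. ''Up to signs and order'' means that one may change the sign of any entry and interchange the two entries in either pair $(A,B)$ or $(C,D)$. *)

(* Defs.v *)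
From mathcomp Require Import all_boot all_order all_algebra.

(* Main.v *)
Require Import Defs.
From mathcomp Require Import all_boot all_order all_algebra.
From mathcomp Require Import zify ring.
Import Order.TTheory GRing.Theory Num.Theory.
Local Open Scope ring_scope.

(** When [A = C] and [B = D] modulo 2, the hypothesis reads [a b = c d] for
    the integers [a = (A + C) / 2], [b = (A - C) / 2], [c = (D - B) / 2] and
    [d = (D + B) / 2], and the four-number lemma splits this as [a = r u],
    [d = s u], [b = s t], [c = r t]; then [v = - t] works.  Since squares are
    0 or 1 modulo 4, the parities match up to exchanging [C] and [D]. *)

(** Division by the gcd leaves coprime cofactors; if both integers vanish, the coprime pair (1, 0)
    with [g = 0] serves. *)
Lemma bezout_cofactors (x y : int) :
  exists m n g p q : int, [/\ x = m * g, y = n * g & p * m + q * n = 1].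
Proof.
have [g0 | gn0] := eqVneq (gcdz x y) 0.
  move/eqP: g0; rewrite gcdz_eq0 => /andP[/eqP-> /eqP->].
  by exists 1, 0, 0, 1, 0.
have xE : x = (x %/ gcdz x y)%Z * gcdz x y by rewrite divzK ?dvdz_gcdl.
have yE : y = (y %/ gcdz x y)%Z * gcdz x y by rewrite divzK ?dvdz_gcdr.
have [p [q pqE]] := Bezoutz x y.
exists (x %/ gcdz x y)%Z, (y %/ gcdz x y)%Z, (gcdz x y), p, q; split=> //.
by apply: (mulIf gn0); rewrite mulrDl -!mulrA -xE -yE mul1r.
Qed.

(** Cancelling [u], the gcd of [a] and [d], leaves [r b = c s] with [r], [s] coprime; the Bezout
    combination [p c + q b] is then the common quotient [b / s = c / r]. *)
Lemma four_number (a b c d : int) :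
  a * b = c * d ->
  exists r s u t : int, [/\ a = r * u, d = s * u, b = s * t & c = r * t].
Proof.
move=> abcd; have [r [s [u [p [q [aE dE pq1]]]]]] := bezout_cofactors a d.
have [u0 | un0] := eqVneq u 0.
  (* Here [a = d = 0] leaves [b] and [c] unrelated, so their own gcd supplies the factors. *)
  have [m [n [g [_ [_ [cE bE _]]]]]] := bezout_cofactors c b.
  by exists m, n, 0, g; split=> //; rewrite mulr0 ?aE ?dE u0 mulr0.
have rb : r * b = c * s.
  by apply: (mulIf un0); rewrite mulrAC -aE -mulrA -dE.
exists r, s, u, (p * c + q * b); split=> //.
  have -> : s * (p * c + q * b) = p * (c * s) + q * s * b by ring.
  by rewrite -rb mulrA -mulrDl pq1 mul1r.
have -> : r * (p * c + q * b) = p * r * c + q * (r * b) by ring.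
by rewrite rb [c * s]mulrC mulrA -mulrDl pq1 mul1r.
Qed.

Lemma eq_sum_sqr_param (A B C D : int) :
  (2 %| A - C)%Z -> (2 %| B - D)%Z -> A ^+ 2 + B ^+ 2 = C ^+ 2 + D ^+ 2 ->
  exists r s u v : int, [/\ A = r * u - s * v, B = r * v + s * u,
    C = r * u + s * v & D = s * u - r * v].
Proof.
move=> /dvdzP[b bE] /dvdzP[c cE].
have -> : A = C + b * 2 by rewrite -bE; ring.
have -> : B = D + c * 2 by rewrite -cE; ring.
move=> h.
(* Here [c] is half of [B - D], hence the minus sign. *)
have /four_number[r [s [u [t [aE dE bE' cE']]]]] :
    (C + b) * b = - c * (D + c) by lia.
by exists r, s, u, (- t); split; lia.
Qed.

Lemma eq_sum_sqr_parity (A B C D : int) :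
  A ^+ 2 + B ^+ 2 = C ^+ 2 + D ^+ 2 ->
  ((2 %| A - C)%Z /\ (2 %| B - D)%Z) \/ ((2 %| A - D)%Z /\ (2 %| B - C)%Z).
Proof.
have parity (x : int) : exists y : int, x = y * 2 \/ x = y * 2 + 1.
  by exists (x %/ 2)%Z; lia.
have [a [->|->]] := parity A; have [b [->|->]] := parity B;
have [c [->|->]] := parity C; have [d [->|->]] := parity D; lia.
Qed.

Theorem theorem1 (A B C D : int) (hABCD : A ^+ 2 + B ^+ 2 = C ^+ 2 + D ^+ 2) :
  exists r s u v : int,
    perm_eq [:: `|A|; `|B|] [:: `|r * u - s * v|; `|r * v + s * u|] /\
    perm_eq [:: `|C|; `|D|] [:: `|r * u + s * v|; `|s * u - r * v|].
Proof.
case: (eq_sum_sqr_parity _ _ _ _ hABCD) => -[hA hB].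
  have [r [s [u [v [-> -> -> ->]]]]] := eq_sum_sqr_param _ _ _ _ hA hB hABCD.
  by exists r, s, u, v.
(* Crossed parities: parametrize with [C] and [D] exchanged, then swap the pair back. *)
rewrite [RHS]addrC in hABCD.
have [r [s [u [v [-> -> -> ->]]]]] := eq_sum_sqr_param _ _ _ _ hA hB hABCD.
exists r, s, u, v; split=> //.
by rewrite -[X in perm_eq X _]/(rot 1 [:: _; _]) perm_rot.
Qed.
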